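(* Let $q$ be a nonzero complex number with $|q|<1$, let $m$ be a nonnegative integer, and let $a,b,c,d,z$ be complex parameters such that all expressions below are well defined (no division by zero occurs). If $|z|<1$ and $|d/a|<1$, then $$ \sum_{k=-m}^{\infty}\frac{(a,b;q)_k\,(cdq^m/abz;q)_k}{(c,d;q)_k\,(q^{1+m};q)_k}\,z^k= \frac{(az,d/a;q)_{\infty}}{(z,d;q)_{\infty}}\cdot\frac{(c/b,\,dq/abz;q)_{m}} {(q/b,\,cd/abz;q)_{m}} \sum_{k=-m}^{\infty}\frac{(a,\,cq^m/b,\,abz/d;q)_{k}} {(c,\,q^{1+m},\,az;q)_{k}}\left(\frac{d}{a}\right)^{k}. $$
   Context: For $|q|<1$, $(x;q)_\infty=\prod_{i\ge 0}(1-xq^i)$, and for any integer $n$, $(x;q)_n=(x;q)_\infty/(xq^n;q)_\infty$. Thus for $n\ge 0$, $(x;q)_n=\prod_{i=0}^{n-1}(1-xq^i)$ and $(x;q)_{-n}=\dfrac{1}{(xq^{-n};q)_n}=\dfrac{(-q/x)^n q^{\binom n2}}{(q/x;q)_n}$. Multi-parameter notation: $(x_1,\ldots,x_r;q)_n=(x_1;q)_n\cdots(x_r;q)_n$ for $n$ an integer or $\infty$. Expressions such as $cdq^m/abz$ mean $cdq^m/(abz)$, and similarly $dq/abz=dq/(abz)$, $cd/abz=cd/(abz)$, while $abz/d=(abz)/d$. *)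

(* Defs.v *)
From Stdlib Require Import Reals ZArith List Lia Lra.
From Coquelicot Require Import Coquelicot.
Import ListNotations.
Open Scope C_scope.

Definition Cpowz (z : C) (k : Z) : C :=
  match k with
  | Z0 => 1
  | Zpos p => z ^ Pos.to_nat p
  | Zneg p => / z ^ Pos.to_nat p
  end.

Fixpoint qpochn (x q : C) (n : nat) : C :=
  match n with
  | O => 1
  | S n => qpochn x q n * (1 - x * q ^ n)
  end.

(** (x;q)_oo, as the limit of the partial products taken componentwise;
    see [qpoch_inf_correct]. *)
Definition qpoch_inf (x q : C) : C :=
  (real (Lim_seq (fun n => Re (qpochn x q n))),
   real (Lim_seq (fun n => Im (qpochn x q n)))).

(** (x;q)_n for an integer n, with (x;q)_{-n} = 1 / (x q^{-n};q)_n. This agrees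
    with (x;q)_oo / (x q^n;q)_oo whenever the latter is defined
    ([qpoch_ratio]), and for n >= 0 it is defined for every x. *)
Definition qpoch (x q : C) (n : Z) : C :=
  match n with
  | Zneg p => / qpochn (x * Cpowz q n) q (Pos.to_nat p)
  | _ => qpochn x q (Z.to_nat n)
  end.

(** The symbol (x;q)_n involves no division by zero. *)
Definition qpoch_wd (x q : C) (n : Z) : Prop :=
  match n with
  | Zneg p => qpochn (x * Cpowz q n) q (Pos.to_nat p) <> 0
  | _ => True
  end.

(** (x_1,...,x_r;q)_n and (x_1,...,x_r;q)_oo *)
Definition qpochs (xs : list C) (q : C) (n : Z) : C :=
  fold_right (fun x p => qpoch x q n * p) 1 xs.

Definition qpochs_inf (xs : list C) (q : C) : C :=
  fold_right (fun x p => qpoch_inf x q * p) 1 xs.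

(** The series of f k over k = -m, -m+1, ... converges to s. *)
Definition is_series_from (m : nat) (f : Z -> C) (s : C) : Prop :=
  @is_series C_AbsRing C_NormedModule
    (fun n : nat => f (Z.of_nat n - Z.of_nat m)%Z) s.

Lemma qpochn_bound (x q : C) (n : nat) : (Cmod q < 1)%R ->
  (Cmod (qpochn x q n) <= exp (Cmod x / (1 - Cmod q)))%R.
Proof.
intros Hq.
assert (H0 := Cmod_ge_0 q); assert (Hx := Cmod_ge_0 x).
apply Rle_trans with
  (exp (Cmod x * ((1 - Cmod q ^ n) / (1 - Cmod q)))).
- induction n as [|n IH]; simpl.
  + replace (Cmod x * ((1 - 1) / (1 - Cmod q)))%R with 0%R by (field; lra).
    rewrite Cmod_1, exp_0; lra.
  + rewrite Cmod_mult.
    replace (Cmod x * ((1 - Cmod q * Cmod q ^ n) / (1 - Cmod q)))%R with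
      (Cmod x * ((1 - Cmod q ^ n) / (1 - Cmod q)) + Cmod x * Cmod q ^ n)%R
      by (field; lra).
    rewrite exp_plus.
    apply Rmult_le_compat; try apply Cmod_ge_0; auto.
    apply Rle_trans with (1 + Cmod x * Cmod q ^ n)%R.
    * eapply Rle_trans; [apply Cmod_triangle|].
      rewrite Cmod_1, Cmod_opp, Cmod_mult, Cmod_pow; lra.
    * apply exp_ineq1_le.
- assert (Hp : (0 <= Cmod q ^ n)%R) by (apply pow_le; auto).
  assert (Hi : (0 < / (1 - Cmod q))%R) by (apply Rinv_0_lt_compat; lra).
  assert (Hle : (Cmod x * ((1 - Cmod q ^ n) / (1 - Cmod q))
                 <= Cmod x / (1 - Cmod q))%R)
    by (unfold Rdiv; apply Rmult_le_compat_l; auto; nra).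
  destruct Hle as [Hlt|He]; [left; now apply exp_increasing | now rewrite He].
Qed.

Lemma C_cvg_components (u : nat -> C) (l : C) :
  filterlim u eventually (@locally C_NormedModule l) ->
  l = (real (Lim_seq (fun n => Re (u n))), real (Lim_seq (fun n => Im (u n)))).
Proof.
intros H.
assert (H1 : is_lim_seq (fun n => Re (u n)) (Re l)).
{ apply filterlim_locally; intros e.
  assert (H1 := proj1 (filterlim_locally u l) H e).
  revert H1; apply filter_imp; intros n Hn; apply Hn. }
assert (H2 : is_lim_seq (fun n => Im (u n)) (Im l)).
{ apply filterlim_locally; intros e.
  assert (H2 := proj1 (filterlim_locally u l) H e).
  revert H2; apply filter_imp; intros n Hn; apply Hn. }
rewrite (is_lim_seq_unique _ _ H1), (is_lim_seq_unique _ _ H2).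
now destruct l.
Qed.

Lemma qpoch_inf_correct (x q : C) : (Cmod q < 1)%R ->
  filterlim (qpochn x q) eventually (@locally C_NormedModule (qpoch_inf x q)).
Proof.
intros Hq.
assert (H0 := Cmod_ge_0 q).
pose (K := (exp (Cmod x / (1 - Cmod q)) * Cmod x)%R).
pose (d := fun n => (- (qpochn x q n * (x * q ^ n)))%C : C).
assert (Hd : @ex_series C_AbsRing C_CompleteNormedModule d).
{ apply (@ex_series_le C_AbsRing C_CompleteNormedModule d
          (fun n => K * Cmod q ^ n)%R).
  - intros n. change (Cmod (d n) <= K * Cmod q ^ n)%R.
    unfold d, K.
    rewrite Cmod_opp, !Cmod_mult, Cmod_pow, <- Rmult_assoc.
    apply Rmult_le_compat_r; [apply pow_le; auto|].
    apply Rmult_le_compat_r; [apply Cmod_ge_0|].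
    now apply qpochn_bound.
  - apply (@ex_series_scal R_AbsRing R_NormedModule K). apply ex_series_geom.
    rewrite Rabs_pos_eq; auto. }
destruct Hd as [s Hs].
assert (Hsum : forall n, qpochn x q (S n) =
    @plus C_NormedModule (RtoC 1) (@sum_n C_NormedModule d n)).
{ induction n as [|n IH].
  - rewrite sum_O. change (1 * (1 - x * 1) = 1 + - (1 * (x * 1))). ring.
  - rewrite sum_Sn.
    change (qpochn x q (S n) * (1 - x * q ^ S n) =
      1 + (@sum_n C_NormedModule d n + d (S n))).
    change (qpochn x q (S n) = 1 + @sum_n C_NormedModule d n) in IH.
    unfold d at 2. rewrite Cplus_assoc, <- IH. ring. }
assert (HL : filterlim (qpochn x q) eventually
    (@locally C_NormedModule (@plus C_NormedModule (RtoC 1) s))).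
{ assert (HS : filterlim (fun n => qpochn x q (S n)) eventually
    (@locally C_NormedModule (@plus C_NormedModule (RtoC 1) s))).
  { eapply filterlim_ext; [intros n; symmetry; apply Hsum|].
    eapply filterlim_comp_2;
      [apply filterlim_const | exact Hs |
       apply (@filterlim_plus C_AbsRing C_NormedModule)]. }
  intros P HP. destruct (HS P HP) as [N HN].
  exists (S N). intros [|n] Hn; [lia|]. apply HN; lia. }
unfold qpoch_inf. rewrite <- (C_cvg_components _ _ HL). exact HL.
Qed.

Lemma qpochn_add (x q : C) (n k : nat) :
  qpochn x q (n + k) = qpochn x q n * qpochn (x * q ^ n) q k.
Proof.
induction k as [|k IH].
- rewrite Nat.add_0_r; simpl; ring.
- rewrite Nat.add_succ_r; simpl; rewrite IH, Cpow_add_r; ring.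
Qed.

Lemma qpoch_inf_split (x q : C) (n : nat) : (Cmod q < 1)%R ->
  qpoch_inf x q = qpochn x q n * qpoch_inf (x * q ^ n) q.
Proof.
intros Hq.
assert (H1 := qpoch_inf_correct x q Hq).
assert (H2 := qpoch_inf_correct (x * q ^ n) q Hq).
apply (@filterlim_locally_unique nat C_AbsRing C_NormedModule eventually _
  (fun k => qpochn x q (n + k))).
- intros P HP. destruct (H1 P HP) as [N HN]. exists N.
  intros k Hk; apply HN; lia.
- apply filterlim_ext with
    (fun k => @scal C_AbsRing C_NormedModule (qpochn x q n)
                (qpochn (x * q ^ n) q k)).
  + intros k; symmetry; apply qpochn_add.
  + eapply filterlim_comp; [exact H2|].
    apply (@filterlim_scal_r C_AbsRing C_NormedModule).
Qed.

Lemma qpoch_ratio (x q : C) (n : Z) : (0 < Cmod q < 1)%R ->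
  qpoch_inf (x * Cpowz q n) q <> 0 ->
  qpoch x q n = qpoch_inf x q / qpoch_inf (x * Cpowz q n) q.
Proof.
intros [Hq0 Hq] Hx.
assert (Hqn : q <> 0) by (apply Cmod_gt_0; auto).
destruct n as [|p|p].
- simpl in *. replace (x * 1) with x in * by ring. field; auto.
- simpl in *. rewrite (qpoch_inf_split x q (Pos.to_nat p) Hq).
  field; auto.
- assert (E := qpoch_inf_split (x * Cpowz q (Zneg p)) q (Pos.to_nat p) Hq).
  replace (x * Cpowz q (Zneg p) * q ^ Pos.to_nat p) with x in E
    by (simpl; field; now apply Cpow_nz).
  unfold qpoch. rewrite E in Hx |- *.
  field; split; intros H; apply Hx; rewrite H; ring.
Qed.

(* Main.v *)
Require Import Defs.
From Stdlib Require Import Reals ZArith List Lia Lra.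
From Coquelicot Require Import Coquelicot.
Import ListNotations.
Open Scope C_scope.

(** Since [(q^(1+m))_(n-m)] is a multiple of [(q)_n], substituting [k = n - m]
    turns both sums into ordinary 3phi2 series ([qpoch_sub]), and the claim
    becomes the transformation of 3phi2(A, B, C; D, E; q, DE/ABC) into
    3phi2(A, D/B, D/C; D, DE/BC; q, E/A) with [A = a q^-m], [B = b q^-m],
    [C = cd/abz], [D = c q^-m], [E = d q^-m] ([phi32_transform]). The factors
    [(x)_(-m)] split off on the way combine to the quotient of symbols of
    length [m] after reversing two of them ([qpochn_reverse]).

    The transformation itself follows by expanding [(B, C)_n / (q, D)_n] with
    the q-Pfaff-Saalschuetz sum ([q_saalschutz]) as a convolution
    [sum_j (D/B, D/C)_j / (q, D)_j w^j (w)_(n-j) / (q)_(n-j)], [w = BC/D],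
    exchanging the summations ([Cseries_swap]) and evaluating each inner sum by
    the q-Gauss sum ([q_gauss]). The exchange is legitimate because the double
    series is dominated by [|E/A|^j |z|^i], and both ratios are below 1.

    The two summation formulas are proved by telescoping. For
    q-Pfaff-Saalschuetz this gives a first-order recurrence in [n]. For q-Gauss
    it gives a relation between the sums with lower parameters [g] and [g q];
    iterating it pushes the argument to 0, where the sum is 1, while the
    accumulated factors converge to the infinite products. *)

(** * Finite sums and limits of complex sequences *)

(** Gives finite sums the type [C] itself, on which [ring] and [field] act. *)
Definition Csum (a : nat -> C) (n : nat) : C := @sum_n C_NormedModule a n.
Local Notation Ccvg u l := (filterlim u eventually (@locally C_NormedModule l)).
Local Notation Cseries := (@is_series C_AbsRing C_NormedModule).

Lemma Csum_0 (a : nat -> C) : Csum a 0 = a 0%nat.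
Proof. apply sum_O. Qed.

Lemma Csum_S (a : nat -> C) (n : nat) : Csum a (S n) = Csum a n + a (S n).
Proof. apply (@sum_Sn C_NormedModule). Qed.

Lemma Csum_ext (a b : nat -> C) (n : nat) :
  (forall k, (k <= n)%nat -> a k = b k) -> Csum a n = Csum b n.
Proof. apply (@sum_n_ext_loc C_NormedModule). Qed.

Lemma Csum_mult_l (c : C) (a : nat -> C) (n : nat) :
  Csum (fun k => c * a k) n = c * Csum a n.
Proof.
induction n as [|n IH]; [now rewrite !Csum_0 |].
rewrite !Csum_S, IH; ring.
Qed.

Lemma Csum_minus (a b : nat -> C) (n : nat) :
  Csum (fun k => a k - b k) n = Csum a n - Csum b n.
Proof.
induction n as [|n IH]; [now rewrite !Csum_0 |].
rewrite !Csum_S, IH; ring.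
Qed.

Lemma Cminus_eq_0 (x y : C) : x - y = 0 -> x = y.
Proof. intros H. rewrite <- (Cplus_0_l y), <- H. ring. Qed.

Lemma Ccvg_unique (u : nat -> C) (l l' : C) : Ccvg u l -> Ccvg u l' -> l = l'.
Proof.
intros H H'.
exact (@filterlim_locally_unique nat C_AbsRing C_NormedModule eventually _
  u l l' H H').
Qed.

Lemma Ccvg_ext (u v : nat -> C) (l : C) :
  (forall n, u n = v n) -> Ccvg u l -> Ccvg v l.
Proof. intros E; now apply filterlim_ext. Qed.

Lemma Ccvg_shift (u : nat -> C) (l : C) (k : nat) :
  Ccvg u l -> Ccvg (fun n => u (k + n)%nat) l.
Proof.
intros H P HP. destruct (H P HP) as [N HN].
exists N. intros n Hn; apply HN; lia.
Qed.

Lemma Ccvg_mult (u v : nat -> C) (l l' : C) :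
  Ccvg u l -> Ccvg v l' -> Ccvg (fun n => u n * v n) (l * l').
Proof.
intros Hu Hv.
eapply (filterlim_comp_2 (G := @locally (AbsRing_UniformSpace C_AbsRing) l)
  u v (@scal C_AbsRing C_NormedModule)); [| exact Hv |].
- intros P HP. apply Hu. now apply locally_C.
- exact (@filterlim_scal C_AbsRing C_NormedModule l l').
Qed.

Lemma Ccvg_minus (u v : nat -> C) (l l' : C) :
  Ccvg u l -> Ccvg v l' -> Ccvg (fun n => u n - v n) (l - l').
Proof.
intros Hu Hv.
eapply (filterlim_comp_2 (H := @locally C_NormedModule (- l')%C)
  u (fun n => - v n) (@plus C_NormedModule)); [exact Hu | |].
- eapply filterlim_comp; [exact Hv |].
  exact (@filterlim_opp C_AbsRing C_NormedModule l').
- exact (@filterlim_plus C_AbsRing C_NormedModule l (- l')).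
Qed.

Lemma Ccvg_Cmod (u : nat -> C) (l : C) :
  Ccvg u l -> is_lim_seq (fun n => Cmod (u n)) (Cmod l).
Proof.
intros H.
eapply filterlim_comp; [exact H |].
exact (@filterlim_norm C_AbsRing C_NormedModule l).
Qed.

Lemma Ccvg_squeeze (u : nat -> C) (l : C) (e : nat -> R) :
  (forall n, Cmod (u n - l) <= e n)%R -> is_lim_seq e 0 -> Ccvg u l.
Proof.
intros Hu He.
apply (proj2 (@filterlim_locally_ball_norm C_AbsRing nat C_NormedModule
  eventually _ u l)).
intros eps.
assert (H := proj1 (filterlim_locally e 0%R) He eps).
revert H; apply filter_imp; intros n Hn.
change (Cmod (u n - l) < eps)%R.
change (Rabs (e n - 0) < eps)%R in Hn.
assert (Hr := Rle_abs (e n - 0)). specialize (Hu n). lra.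
Qed.

Lemma Ccvg_Cmod_le (u : nat -> C) (l : C) (B : R) :
  (forall n, Cmod (u n) <= B)%R -> Ccvg u l -> (Cmod l <= B)%R.
Proof.
intros Hu H.
exact (is_lim_seq_le _ (fun _ => B) _ B Hu (Ccvg_Cmod _ _ H)
  (is_lim_seq_const B)).
Qed.

(** * Series dominated by a geometric series *)

Lemma geom_sum_le (r : R) (n : nat) : (0 <= r < 1)%R ->
  (sum_n (fun k => r ^ k)%R n <= / (1 - r))%R.
Proof.
intros Hr.
assert (E : (sum_n (fun k => r ^ k)%R n * (1 - r) = 1 - r ^ S n)%R).
{ induction n as [|n IH].
  - rewrite sum_O; simpl; ring.
  - rewrite sum_Sn; change plus with Rplus.
    rewrite Rmult_plus_distr_r, IH; simpl; ring. }
assert (Hp : (0 <= r ^ S n)%R) by (apply pow_le; lra).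
apply Rmult_le_reg_r with (1 - r)%R; [lra |].
rewrite E, Rinv_l; lra.
Qed.

Lemma geom_Csum_le (a : nat -> C) (K r : R) (n : nat) : (0 <= r < 1)%R ->
  (forall k, Cmod (a k) <= K * r ^ k)%R -> (Cmod (Csum a n) <= K / (1 - r))%R.
Proof.
intros Hr Ha.
assert (HK : (0 <= K)%R).
{ specialize (Ha 0%nat); simpl in Ha. assert (H := Cmod_ge_0 (a 0%nat)). lra. }
apply Rle_trans with (K * sum_n (fun k => r ^ k)%R n)%R.
- induction n as [|n IH].
  + rewrite Csum_0, sum_O. apply Ha.
  + rewrite Csum_S, sum_Sn; change plus with Rplus.
    eapply Rle_trans; [apply Cmod_triangle |].
    specialize (Ha (S n)). lra.
- apply Rmult_le_compat_l; auto. now apply geom_sum_le.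
Qed.

Lemma geom_Cseries (a : nat -> C) (K r : R) : (0 <= r < 1)%R ->
  (forall k, Cmod (a k) <= K * r ^ k)%R -> exists s, Cseries a s.
Proof.
intros Hr Ha.
apply (@ex_series_le C_AbsRing C_CompleteNormedModule a
  (fun n => K * r ^ n)%R Ha).
apply (@ex_series_scal R_AbsRing R_NormedModule K). apply ex_series_geom.
rewrite Rabs_pos_eq; lra.
Qed.

Lemma Cseries_mult_l (c : C) (a : nat -> C) (s : C) :
  Cseries a s -> Cseries (fun n => c * a n) (c * s).
Proof. apply (@is_series_scal C_AbsRing C_NormedModule). Qed.

(** The explicit tail bound does two jobs: it controls the rows when a double
    series is rearranged, and with [n = 0] it shows that a series tends to its
    first term when the ratio [r] tends to 0. *)
Lemma geom_tail_le (a : nat -> C) (s : C) (K r : R) (n : nat) : (0 <= r < 1)%R ->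
  (forall k, Cmod (a k) <= K * r ^ k)%R -> Cseries a s ->
  (Cmod (s - Csum a n) <= K * r ^ S n / (1 - r))%R.
Proof.
intros Hr Ha Hs.
apply Ccvg_Cmod_le with (fun k => Csum (fun i => a (S n + i)%nat) k).
- intros k. apply geom_Csum_le; auto.
  intros i. eapply Rle_trans; [apply Ha |]. rewrite pow_add; lra.
- apply Ccvg_ext with (fun k => Csum a (S n + k) - Csum a n).
  + induction n0 as [|k IH].
    * rewrite Csum_0, Nat.add_0_r, Csum_S; ring.
    * rewrite Nat.add_succ_r, !Csum_S, <- IH, Nat.add_succ_r; ring.
  + apply Ccvg_minus; [| apply filterlim_const].
    now apply (Ccvg_shift (Csum a) s (S n)).
Qed.

(** * Rearrangement of double series *)

(** Both sides add up [t j i] over the triangle [j + i <= N]. *)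
Lemma Csum_triangle (t : nat -> nat -> C) (N : nat) :
  Csum (fun n => Csum (fun j => t j (n - j)%nat) n) N =
  Csum (fun j => Csum (t j) (N - j)) N.
Proof.
induction N as [|N IH].
- now rewrite !Csum_0.
- rewrite Csum_S, IH, !Csum_S, Nat.sub_diag, Csum_0, Cplus_assoc.
  f_equal.
  rewrite (Csum_ext (fun j => Csum (t j) (S N - j))
    (fun j => Csum (t j) (N - j) - - t j (S N - j)%nat)).
  + rewrite Csum_minus.
    rewrite (Csum_ext (fun j => - t j (S N - j)%nat)
      (fun j => - (1) * t j (S N - j)%nat)) by (intros; ring).
    rewrite Csum_mult_l. ring.
  + intros k Hk. rewrite Nat.sub_succ_l, Csum_S by auto. ring.
Qed.

Lemma lim_scal_geom (K r : R) : (0 <= r < 1)%R ->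
  is_lim_seq (fun n => K * r ^ n)%R 0.
Proof.
intros Hr. replace (Finite 0) with (Rbar_mult K 0) by (simpl; f_equal; ring).
apply is_lim_seq_scal_l, is_lim_seq_geom. rewrite Rabs_pos_eq; lra.
Qed.

Lemma lim_nat_geom (r : R) : (0 <= r < 1)%R ->
  is_lim_seq (fun n => INR (S n) * r ^ n)%R 0.
Proof.
intros Hr.
destruct (Req_dec r 0) as [->|Hr0].
- apply is_lim_seq_incr_1.
  apply is_lim_seq_ext with (fun _ => 0%R); [intros n; simpl; ring |].
  apply is_lim_seq_const.
- apply ex_series_lim_0.
  apply ex_series_ext with (fun n => Rabs (INR (S n) * r ^ n)%R).
  { intros n. apply Rabs_pos_eq. apply Rmult_le_pos; [apply pos_INR |].
    apply pow_le; lra. }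
  apply ex_series_DAlembert with r; [lra | |].
  + intros n. apply Rmult_integral_contrapositive; split.
    * apply not_0_INR; lia.
    * now apply pow_nonzero.
  + apply is_lim_seq_ext with (fun n => r * (1 + / INR (S n)))%R.
    * intros n. assert (H : (0 < INR (S n))%R) by (apply lt_0_INR; lia).
      assert (H' := pow_nonzero r n Hr0).
      rewrite (S_INR (S n)).
      replace ((INR (S n) + 1) * r ^ S n / (INR (S n) * r ^ n))%R with
        (r * (1 + / INR (S n)))%R by (simpl pow; field; split; auto; lra).
      symmetry; apply Rabs_pos_eq.
      assert (Hi := Rinv_0_lt_compat _ H). apply Rmult_le_pos; lra.
    * replace (Finite r) with (Rbar_mult r (1 + 0)%R) by (simpl; f_equal; ring).
      apply is_lim_seq_scal_l.
      apply is_lim_seq_plus'; [apply is_lim_seq_const |].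
      apply (is_lim_seq_incr_1 (fun n => / INR n)%R).
      replace (Finite 0) with (Rbar_inv p_infty) by reflexivity.
      apply is_lim_seq_inv; [apply is_lim_seq_INR | discriminate].
Qed.

(** Rearrangement of a double series. The diagonals up to [N] cover a triangle,
    and the row [j] of that triangle misses its full sum by a tail of size
    O(r^N). There are [N + 1] rows, so the total error is O((N + 1) r^N) and
    tends to 0. *)
Lemma Cseries_swap (t : nat -> nat -> C) (rows : nat -> C) (s : C) (K r : R) :
  (0 <= r < 1)%R -> (forall j i, Cmod (t j i) <= K * r ^ (j + i))%R ->
  (forall j, Cseries (t j) (rows j)) -> Cseries rows s ->
  Cseries (fun n => Csum (fun j => t j (n - j)%nat) n) s.
Proof.
intros Hr Ht Hrow Hs.
(* Triangle against full rows: [N + 1] tails, each at most [K r^(N+1) / (1-r)]. *)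
assert (Hdiff : forall N,
  (Cmod (Csum (fun n => Csum (fun j => t j (n - j)%nat) n) N - Csum rows N)
   <= K / (1 - r) * (INR (S N) * r ^ N))%R).
{ intros N. rewrite Csum_triangle, <- Csum_minus.
  assert (HK : (0 <= K)%R).
  { specialize (Ht 0%nat 0%nat); simpl in Ht.
    assert (H := Cmod_ge_0 (t 0%nat 0%nat)). lra. }
  assert (Hterm : forall j, (j <= N)%nat ->
    (Cmod (Csum (t j) (N - j) - rows j) <= K / (1 - r) * r ^ N)%R).
  { intros j Hj.
    replace (Csum (t j) (N - j) - rows j) with (- (rows j - Csum (t j) (N - j)))
      by ring.
    rewrite Cmod_opp.
    eapply Rle_trans.
    { apply (geom_tail_le (t j) (rows j) (K * r ^ j) r); auto.
      intros i. rewrite Rmult_assoc, <- pow_add. apply Ht. }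
    replace (K * r ^ j * r ^ S (N - j) / (1 - r))%R with
      (K / (1 - r) * (r * r ^ N))%R.
    - assert (Hp : (0 <= r ^ N)%R) by (apply pow_le; lra).
      apply Rmult_le_compat_l; [apply Rdiv_le_0_compat; lra | nra].
    - replace (r ^ N)%R with (r ^ j * r ^ (N - j))%R
        by (rewrite <- pow_add; f_equal; lia).
      simpl; field; lra. }
  assert (Hgen : forall M, (M <= N)%nat ->
    (Cmod (Csum (fun j => (Csum (t j) (N - j) - rows j)%C) M)
      <= INR (S M) * (K / (1 - r) * r ^ N))%R).
  { induction M as [|M IH]; intros HM.
    - rewrite Csum_0. simpl INR. rewrite Rmult_1_l. now apply Hterm.
    - rewrite Csum_S, (S_INR (S M)).
      eapply Rle_trans; [apply Cmod_triangle |].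
      specialize (IH ltac:(lia)). specialize (Hterm (S M) HM). lra. }
  specialize (Hgen N (le_n N)). lra. }
assert (Hz : Ccvg (fun N => Csum (fun n => Csum (fun j => t j (n - j)%nat) n) N
                            - Csum rows N) (RtoC 0)).
{ eapply Ccvg_squeeze; [intros N; replace (_ - 0) with
    (Csum (fun n => Csum (fun j => t j (n - j)%nat) n) N - Csum rows N) by ring;
    apply Hdiff |].
  replace (Finite 0) with (Rbar_mult (K / (1 - r))%R 0) by (simpl; f_equal; ring).
  apply is_lim_seq_scal_l. now apply lim_nat_geom. }
assert (H := Ccvg_minus _ _ _ _ Hz (Ccvg_minus (fun _ => RtoC 0) (Csum rows) _ _
  (filterlim_const (RtoC 0)) Hs)).
replace s with (0 - (0 - s)) by ring.
refine (Ccvg_ext _ (Csum (fun n => Csum (fun j => t j (n - j)%nat) n)) _ _ H).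
intros n. ring.
Qed.

(** * Bounds for q-shifted factorials *)

Definition Cbounded (u : nat -> C) : Prop :=
  exists K : R, forall n, (Cmod (u n) <= K)%R.

Lemma Cbounded_mult (u v : nat -> C) :
  Cbounded u -> Cbounded v -> Cbounded (fun n => u n * v n).
Proof.
intros [K HK] [L HL]. exists (K * L)%R. intros n.
rewrite Cmod_mult. apply Rmult_le_compat; auto; apply Cmod_ge_0.
Qed.

Lemma qpochn_bounded (x q : C) : (Cmod q < 1)%R -> Cbounded (qpochn x q).
Proof. intros Hq. eexists. intros n. now apply qpochn_bound. Qed.

Lemma qpochn_succ_l (x q : C) (n : nat) :
  qpochn x q (S n) = (1 - x) * qpochn (x * q) q n.
Proof.
change (S n) with (1 + n)%nat. rewrite qpochn_add.
replace (x * q ^ 1) with (x * q) by (simpl; ring). simpl; ring.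
Qed.

(** Union-bound estimate: [|prod (1 - x q^i)| >= 1 - sum |x q^i|], and the
    geometric sum is at most 1/2. *)
Lemma qpochn_tail_ge (x q : C) (n : nat) : (Cmod q < 1)%R ->
  (Cmod x <= (1 - Cmod q) / 2)%R -> (/ 2 <= Cmod (qpochn x q n))%R.
Proof.
intros Hq Hx.
assert (H0 := Cmod_ge_0 q); assert (Hx0 := Cmod_ge_0 x).
apply Rle_trans with (1 - Cmod x * ((1 - Cmod q ^ n) / (1 - Cmod q)))%R.
- assert (Hp : (0 <= Cmod q ^ n)%R) by (apply pow_le; auto).
  assert (Hd : (Cmod x * ((1 - Cmod q ^ n) / (1 - Cmod q)) <=
    (1 - Cmod q) / 2 * (1 / (1 - Cmod q)))%R).
  { apply Rmult_le_compat; auto.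
    - apply Rdiv_le_0_compat; [| lra].
      assert (Cmod q ^ n <= 1 ^ n)%R by (apply pow_incr; lra).
      rewrite pow1 in H; lra.
    - apply Rmult_le_compat_r; [left; apply Rinv_0_lt_compat; lra | lra]. }
  replace ((1 - Cmod q) / 2 * (1 / (1 - Cmod q)))%R with (/ 2)%R in Hd
    by (field; lra).
  lra.
- induction n as [|n IH].
  + simpl. rewrite Cmod_1. right; field; lra.
  + simpl. rewrite Cmod_mult.
    assert (Hp : (0 <= Cmod q ^ n <= 1)%R).
    { split; [apply pow_le; auto |].
      rewrite <- (pow1 n). apply pow_incr; lra. }
    assert (Hf : (1 - Cmod x * Cmod q ^ n <= Cmod (1 - x * q ^ n))%R).
    { assert (Ht := Cmod_triangle (1 - x * q ^ n) (x * q ^ n)).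
      replace (1 - x * q ^ n + x * q ^ n) with (RtoC 1) in Ht by ring.
      rewrite Cmod_1, Cmod_mult, Cmod_pow in Ht. lra. }
    set (s := ((1 - Cmod q ^ n) / (1 - Cmod q))%R) in *.
    replace ((1 - Cmod q * Cmod q ^ n) / (1 - Cmod q))%R with
      (s + Cmod q ^ n)%R by (unfold s; field; lra).
    assert (Hs : (0 <= s)%R) by (apply Rdiv_le_0_compat; lra).
    assert (Hu : (Cmod x * Cmod q ^ n <= 1)%R).
    { apply Rle_trans with (Cmod x * 1)%R; [apply Rmult_le_compat_l; lra | lra]. }
    eapply Rle_trans with ((1 - Cmod x * s) * (1 - Cmod x * Cmod q ^ n))%R.
    * assert (0 <= Cmod x * s)%R by now apply Rmult_le_pos.
      assert (0 <= Cmod x * Cmod q ^ n)%R by (apply Rmult_le_pos; lra).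
      nra.
    * apply Rle_trans with
        (Cmod (qpochn x q n) * (1 - Cmod x * Cmod q ^ n))%R.
      -- apply Rmult_le_compat_r; lra.
      -- apply Rmult_le_compat_l; [apply Cmod_ge_0 | auto].
Qed.

(** Only finitely many factors [1 - x q^i] can be far from 1: after removing
    them one at a time, the remaining product falls under [qpochn_tail_ge]. *)
Lemma qpochn_ge (x q : C) : (Cmod q < 1)%R ->
  (forall n, qpochn x q n <> 0) ->
  exists e : R, (0 < e)%R /\ forall n, (e <= Cmod (qpochn x q n))%R.
Proof.
intros Hq Hx.
assert (H0 := Cmod_ge_0 q).
assert (HN : exists N, (Cmod (x * q ^ N) <= (1 - Cmod q) / 2)%R).
{ assert (Hl : is_lim_seq (fun n => Cmod x * Cmod q ^ n)%R 0)
    by now apply lim_scal_geom.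
  assert (He : (0 < (1 - Cmod q) / 2)%R) by lra.
  destruct (proj1 (filterlim_locally _ _) Hl (mkposreal _ He)) as [N HN].
  exists N. specialize (HN N (le_n N)).
  change (Rabs (Cmod x * Cmod q ^ N - 0) < (1 - Cmod q) / 2)%R in HN.
  rewrite Cmod_mult, Cmod_pow.
  assert (Ha := Rle_abs (Cmod x * Cmod q ^ N - 0)). lra. }
destruct HN as [N HN].
revert x Hx HN. induction N as [|N IH]; intros x Hx HN.
- exists (/ 2)%R. split; [lra |]. intros n. apply qpochn_tail_ge; auto.
  simpl in HN. now rewrite Cmult_1_r in HN.
- destruct (IH (x * q)) as [e [He Hle]].
  + intros n Hn. apply (Hx (S n)). rewrite qpochn_succ_l, Hn. ring.
  + now replace (x * q * q ^ N) with (x * q ^ S N) by (simpl; ring).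
  + assert (H1 : (0 < Cmod (1 - x))%R).
    { apply Cmod_gt_0. intros E. apply (Hx 1%nat). rewrite qpochn_succ_l, E. ring. }
    exists (Rmin 1 (Cmod (1 - x) * e)). split.
    * apply Rmin_glb_lt; [lra | now apply Rmult_lt_0_compat].
    * intros [|n].
      -- simpl. rewrite Cmod_1. apply Rmin_l.
      -- eapply Rle_trans; [apply Rmin_r |].
         rewrite qpochn_succ_l, Cmod_mult. apply Rmult_le_compat_l; auto; lra.
Qed.

Lemma qpochn_inv_bounded (x q : C) : (Cmod q < 1)%R ->
  (forall n, qpochn x q n <> 0) -> Cbounded (fun n => / qpochn x q n).
Proof.
intros Hq Hx. destruct (qpochn_ge x q Hq Hx) as [e [He Hle]].
exists (/ e)%R. intros n. rewrite Cmod_inv by apply Hx.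
now apply Rinv_le_contravar.
Qed.

Lemma Cmod_pow_le_1 (q : C) (n : nat) : (Cmod q < 1)%R -> (Cmod q ^ n <= 1)%R.
Proof.
intros Hq. rewrite <- (pow1 n). apply pow_incr.
split; [apply Cmod_ge_0 | lra].
Qed.

Lemma Cmod_mult_pow_le (x q : C) (n : nat) : (Cmod q < 1)%R ->
  (Cmod (x * q ^ n) <= Cmod x)%R.
Proof.
intros Hq. rewrite Cmod_mult, Cmod_pow.
assert (H := Cmod_pow_le_1 q n Hq). assert (H1 := Cmod_ge_0 x). nra.
Qed.

Lemma qpochn_neq_0 (x q : C) (n : nat) : (Cmod x < 1)%R -> (Cmod q < 1)%R ->
  qpochn x q n <> 0.
Proof.
intros Hx Hq. induction n as [|n IH]; simpl; [apply C1_nz |].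
apply Cmult_neq_0; auto. intros E.
assert (H : x * q ^ n = 1) by (rewrite <- (Cplus_0_l (x * q ^ n)), <- E; ring).
assert (H1 := Cmod_mult_pow_le x q n Hq). rewrite H, Cmod_1 in H1. lra.
Qed.

(** The lower bound [qpochn_ge] survives in the limit. *)
Lemma qpoch_inf_neq_0 (x q : C) : (Cmod q < 1)%R ->
  (forall n, qpochn x q n <> 0) -> qpoch_inf x q <> 0.
Proof.
intros Hq Hx E. destruct (qpochn_ge x q Hq Hx) as [e [He Hle]].
assert (H := Ccvg_Cmod _ _ (qpoch_inf_correct x q Hq)).
assert (H1 := is_lim_seq_le (fun _ => e) _ e _ Hle (is_lim_seq_const e) H).
rewrite E, Cmod_0 in H1. simpl in H1. lra.
Qed.

Lemma qpochn_S (x q : C) (n : nat) :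
  qpochn x q (S n) = qpochn x q n * (1 - x * q ^ n).
Proof. reflexivity. Qed.

Lemma qpochn_S_neq_0 (x q : C) (n : nat) : qpochn x q (S n) <> 0 ->
  qpochn x q n <> 0 /\ 1 - x * q ^ n <> 0.
Proof.
intros H. split; intros E; apply H; rewrite qpochn_S, E; ring.
Qed.

(** * The q-Pfaff-Saalschuetz sum *)

(** The terms are indexed by [j] and [i = n - j], which keeps every exponent a
    natural number; reversing the factors with index [i] gives the usual
    terminating balanced 3phi2. *)
Definition saalschutz_term (P Q w q : C) (j i : nat) : C :=
  qpochn P q j * qpochn Q q j / (qpochn q q j * qpochn (P * Q * w) q j) * w ^ j
  * (qpochn w q i / qpochn q q i).

(** The certificate behind [q_saalschutz]: the recurrence in [n] expected of the
    sum holds term by term up to a difference in [j], whose partial sums have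
    the closed form on the right. *)
Lemma saalschutz_telescope (P Q w q : C) (n J : nat) : (Cmod q < 1)%R ->
  (forall k, qpochn (P * Q * w) q k <> 0) -> (J <= n)%nat ->
  Csum (fun j => (1 - q * q ^ n) * (1 - P * Q * w * q ^ n)
                   * saalschutz_term P Q w q j (S n - j)
                 - (1 - P * w * q ^ n) * (1 - Q * w * q ^ n)
                   * saalschutz_term P Q w q j (n - j)) J =
  - (q ^ (n - J) * w * (1 - P * q ^ J) * (1 - Q * q ^ J)
     * saalschutz_term P Q w q J (n - J)).
Proof.
intros Hq HM.
assert (Hqn : forall k, qpochn q q k <> 0) by (intros k; now apply qpochn_neq_0).
induction J as [|J IH]; intros HJ.
- rewrite Csum_0, !Nat.sub_0_r. unfold saalschutz_term.
  rewrite !qpochn_S. simpl (_ ^ 0). simpl (qpochn _ _ 0).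
  destruct (qpochn_S_neq_0 _ _ _ (Hqn (S n))).
  field. repeat split; auto.
- rewrite Csum_S, IH by lia.
  replace (n - J)%nat with (S (n - S J)) by lia.
  replace (S n - S J)%nat with (S (n - S J)) by lia.
  replace (q ^ n) with (q * q ^ J * q ^ (n - S J))
    by (rewrite <- Cpow_S, <- Cpow_add_r; f_equal; lia).
  set (i := (n - S J)%nat). unfold saalschutz_term.
  rewrite !qpochn_S, !Cpow_S.
  destruct (qpochn_S_neq_0 _ _ _ (Hqn (S i))).
  destruct (qpochn_S_neq_0 _ _ _ (Hqn (S J))).
  destruct (qpochn_S_neq_0 _ _ _ (HM (S J))).
  field. repeat split; auto.
Qed.

(** The q-Pfaff-Saalschuetz sum. At [J = n] the right-hand side of
    [saalschutz_telescope] cancels the contribution of the remaining term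
    [j = n + 1], so both sides satisfy the same first-order recurrence in [n]. *)
Lemma q_saalschutz (P Q w q : C) (n : nat) : (Cmod q < 1)%R ->
  (forall k, qpochn (P * Q * w) q k <> 0) ->
  Csum (fun j => saalschutz_term P Q w q j (n - j)) n =
  qpochn (P * w) q n * qpochn (Q * w) q n
  / (qpochn q q n * qpochn (P * Q * w) q n).
Proof.
intros Hq HM.
assert (Hqn : forall k, qpochn q q k <> 0) by (intros k; now apply qpochn_neq_0).
induction n as [|n IH].
- rewrite Csum_0. unfold saalschutz_term. simpl. field.
- assert (H := saalschutz_telescope P Q w q n n Hq HM (le_n n)).
  rewrite Csum_minus, !Csum_mult_l, IH in H.
  rewrite Csum_S, !Nat.sub_diag in *.
  destruct (qpochn_S_neq_0 _ _ _ (Hqn (S n))) as [Hq1 Hq2].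
  destruct (qpochn_S_neq_0 _ _ _ (HM (S n))) as [HM1 HM2].
  set (s := Csum (fun j => saalschutz_term P Q w q j (S n - j)) n) in *.
  assert (E : s = ((1 - P * w * q ^ n) * (1 - Q * w * q ^ n) *
       (qpochn (P * w) q n * qpochn (Q * w) q n /
        (qpochn q q n * qpochn (P * Q * w) q n))
       - q ^ 0 * w * (1 - P * q ^ n) * (1 - Q * q ^ n) * saalschutz_term P Q w q n 0)
       / ((1 - q * q ^ n) * (1 - P * Q * w * q ^ n))).
  { set (X := saalschutz_term _ _ _ _ _ _) in *.
    set (Y := _ / (qpochn q q n * _)) in *.
    transitivity (((1 - q * q ^ n) * (1 - P * Q * w * q ^ n) * s
      - (1 - P * w * q ^ n) * (1 - Q * w * q ^ n) * Y
      + (1 - P * w * q ^ n) * (1 - Q * w * q ^ n) * Y)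
      / ((1 - q * q ^ n) * (1 - P * Q * w * q ^ n))).
    - field. split; auto.
    - rewrite H. field. split; auto. }
  rewrite E. unfold saalschutz_term. rewrite !qpochn_S. simpl (qpochn _ _ 0).
  rewrite !Cpow_S. simpl (q ^ 0).
  field. repeat split; auto.
Qed.

(** * The q-Gauss sum *)

(** General term of 2phi1(a, b; abx; q, x). Making [x] a parameter and the lower
    parameter the product [abx] avoids dividing by [a] and [b], and turns the
    shift of the lower parameter by [q] into [x -> x q]. *)
Definition gauss_term (a b x q : C) (n : nat) : C :=
  qpochn a q n * qpochn b q n / (qpochn q q n * qpochn (a * b * x) q n) * x ^ n.

(** Gosper-type certificate for the contiguous relation between [x] and [x q]:
    the difference of the two partial sums is a boundary term. *)
Lemma gauss_telescope (a b x q : C) (N : nat) : (Cmod q < 1)%R ->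
  (forall k, qpochn (a * b * x) q k <> 0) ->
  (1 - a * b * x) * (1 - x) * Csum (gauss_term a b x q) N
  - (1 - a * x) * (1 - b * x) * Csum (gauss_term a b (x * q) q) N =
  - ((1 - a * b * x) * (1 - q * q ^ N) * gauss_term a b x q (S N)).
Proof.
intros Hq Hg.
assert (Hqn : forall k, qpochn q q k <> 0) by (intros k; now apply qpochn_neq_0).
assert (Hg1 : 1 - a * b * x <> 0).
{ intros E. apply (Hg 1%nat). rewrite qpochn_succ_l, E. ring. }
assert (Hs : forall k, qpochn (a * b * (x * q)) q k =
  qpochn (a * b * x) q k * (1 - a * b * x * q ^ k) / (1 - a * b * x)).
{ intros k. rewrite <- qpochn_S, qpochn_succ_l, Cmult_assoc. field; auto. }
induction N as [|N IH].
- rewrite !Csum_0. unfold gauss_term. simpl.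
  assert (H : 1 - q <> 0).
  { intros E. apply (Hqn 1%nat). rewrite qpochn_succ_l, E. ring. }
  field. repeat split; auto.
- rewrite !Csum_S.
  transitivity ((1 - a * b * x) * (1 - x) * gauss_term a b x q (S N) -
    (1 - a * x) * (1 - b * x) * gauss_term a b (x * q) q (S N) +
    ((1 - a * b * x) * (1 - x) * Csum (gauss_term a b x q) N
  - (1 - a * x) * (1 - b * x) * Csum (gauss_term a b (x * q) q) N)); [ring |].
  rewrite IH. unfold gauss_term. rewrite Hs.
  rewrite Cpow_mult_l.
  destruct (qpochn_S_neq_0 _ _ _ (Hqn (S (S N)))) as [Hq1 Hq2].
  destruct (qpochn_S_neq_0 _ _ _ (Hg (S (S N)))) as [HM1 HM2].
  apply qpochn_S_neq_0 in Hq1, HM1.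
  destruct Hq1, HM1.
  rewrite !qpochn_S, !Cpow_S in *.
  field. repeat split; auto.
Qed.

(** The bound is uniform in [N]: the shifted lower symbol is the quotient
    [(abx)_(N+n) / (abx)_N], which is bounded away from 0. *)
Lemma gauss_term_bound (a b x q : C) : (Cmod q < 1)%R ->
  (forall k, qpochn (a * b * x) q k <> 0) ->
  exists K : R, forall N n,
    (Cmod (gauss_term a b (x * q ^ N) q n) <= K * Cmod (x * q ^ N) ^ n)%R.
Proof.
intros Hq Hg.
assert (Hqn : forall k, qpochn q q k <> 0) by (intros k; now apply qpochn_neq_0).
destruct (Cbounded_mult _ _ (Cbounded_mult _ _ (qpochn_bounded a q Hq)
  (qpochn_bounded b q Hq)) (qpochn_inv_bounded q q Hq Hqn)) as [K1 H1].
destruct (qpochn_bounded (a * b * x) q Hq) as [K2 H2].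
destruct (qpochn_inv_bounded _ q Hq Hg) as [K3 H3].
exists (K1 * (K2 * K3))%R. intros N n.
assert (HN : qpochn (a * b * (x * q ^ N)) q n =
  qpochn (a * b * x) q (N + n) / qpochn (a * b * x) q N).
{ rewrite qpochn_add, Cmult_assoc. field. auto. }
unfold gauss_term. rewrite HN.
replace (_ / _ * _) with (qpochn a q n * qpochn b q n * / qpochn q q n
  * (qpochn (a * b * x) q N * / qpochn (a * b * x) q (N + n)) * (x * q ^ N) ^ n)
  by (field; repeat split; auto).
rewrite (Cmod_mult _ ((x * q ^ N) ^ n)), Cmod_pow.
apply Rmult_le_compat_r; [apply pow_le, Cmod_ge_0 |].
rewrite (Cmod_mult _ (_ * / _)). apply Rmult_le_compat; auto using Cmod_ge_0.
rewrite Cmod_mult. apply Rmult_le_compat; auto using Cmod_ge_0.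
Qed.

(** The boundary term of [gauss_telescope] tends to 0 since [|x| < 1]. *)
Lemma gauss_contiguous (a b x q s s' : C) : (Cmod q < 1)%R -> (Cmod x < 1)%R ->
  (forall k, qpochn (a * b * x) q k <> 0) ->
  Cseries (gauss_term a b x q) s -> Cseries (gauss_term a b (x * q) q) s' ->
  (1 - a * b * x) * (1 - x) * s = (1 - a * x) * (1 - b * x) * s'.
Proof.
intros Hq Hx Hg Hs Hs'.
destruct (gauss_term_bound a b x q Hq Hg) as [K HK].
specialize (HK 0%nat). simpl in HK. rewrite Cmult_1_r in HK.
apply Cminus_eq_0.
apply Cseries_mult_l with (c := (1 - a * b * x) * (1 - x)) in Hs.
apply Cseries_mult_l with (c := (1 - a * x) * (1 - b * x)) in Hs'.
assert (H := Ccvg_minus _ _ _ _ Hs Hs').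
refine (Ccvg_unique _ _ _ H _).
apply Ccvg_squeeze with (fun n =>
  (Cmod (1 - a * b * x) * 2 * K * Cmod x) * Cmod x ^ n)%R.
- intros n.
  change (Cmod (Csum (fun n => (1 - a * b * x) * (1 - x) * gauss_term a b x q n) n
    - Csum (fun n => (1 - a * x) * (1 - b * x) * gauss_term a b (x * q) q n) n
    - 0)%C <= Cmod (1 - a * b * x) * 2 * K * Cmod x * Cmod x ^ n)%R.
  rewrite !Csum_mult_l, gauss_telescope by auto.
  unfold Cminus at 1. rewrite Copp_0, Cplus_0_r, Cmod_opp, !Cmod_mult.
  apply Rle_trans with
    (Cmod (1 - a * b * x) * 2 * (K * Cmod x ^ S n))%R; [| simpl; lra].
  apply Rmult_le_compat; auto using Cmod_ge_0.
  + apply Rmult_le_pos; apply Cmod_ge_0.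
  + apply Rmult_le_compat_l; [apply Cmod_ge_0 |].
    eapply Rle_trans; [apply Cmod_triangle |].
    rewrite Cmod_1, Cmod_opp, <- Cpow_S, Cmod_pow.
    assert (H1 := Cmod_pow_le_1 q (S n) Hq). lra.
- apply lim_scal_geom. split; [apply Cmod_ge_0 | auto].
Qed.

Lemma gauss_iterate (a b q : C) (N : nat) : (Cmod q < 1)%R ->
  forall x s s' : C, (Cmod x < 1)%R ->
  (forall k, qpochn (a * b * x) q k <> 0) ->
  Cseries (gauss_term a b x q) s -> Cseries (gauss_term a b (x * q ^ N) q) s' ->
  qpochn (a * b * x) q N * qpochn x q N * s =
  qpochn (a * x) q N * qpochn (b * x) q N * s'.
Proof.
intros Hq. induction N as [|N IH]; intros x s s' Hx Hg Hs Hs'.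
- simpl in Hs'. rewrite Cmult_1_r in Hs'.
  rewrite (Ccvg_unique _ _ _ Hs Hs'). reflexivity.
- assert (Hg' : forall k, qpochn (a * b * (x * q)) q k <> 0).
  { intros k E. apply (Hg (S k)).
    rewrite qpochn_succ_l.
    replace (a * b * x * q) with (a * b * (x * q)) by ring. rewrite E. ring. }
  destruct (gauss_term_bound a b x q Hq Hg) as [K HK].
  specialize (HK 1%nat). rewrite Cpow_1_r in HK.
  assert (Hxq : (Cmod (x * q) < 1)%R).
  { assert (H := Cmod_mult_pow_le x q 1 Hq). rewrite Cpow_1_r in H. lra. }
  destruct (geom_Cseries _ K (Cmod (x * q)) (conj (Cmod_ge_0 _) Hxq) HK)
    as [s1 Hs1].
  replace (x * q ^ S N) with (x * q * q ^ N) in Hs' by (simpl; ring).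
  assert (E := IH _ _ _ Hxq Hg' Hs1 Hs').
  assert (E1 := gauss_contiguous _ _ _ _ _ _ Hq Hx Hg Hs Hs1).
  rewrite !qpochn_succ_l.
  replace (a * b * x * q) with (a * b * (x * q)) by ring.
  replace (a * x * q) with (a * (x * q)) by ring.
  replace (b * x * q) with (b * (x * q)) by ring.
  transitivity (qpochn (a * b * (x * q)) q N * qpochn (x * q) q N
    * ((1 - a * b * x) * (1 - x) * s)); [ring |].
  rewrite E1.
  transitivity ((1 - a * x) * (1 - b * x) *
    (qpochn (a * b * (x * q)) q N * qpochn (x * q) q N * s1)); [ring |].
  rewrite E. ring.
Qed.

(** The q-Gauss sum. Iterating [gauss_contiguous] expresses the sum at [x] by
    finite products times the sum at [x q^N]; the latter tends to 1 because all
    its terms but the first carry a power of [x q^N]. *)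
Lemma q_gauss (a b x q : C) : (Cmod q < 1)%R -> (Cmod x < 1)%R ->
  (forall k, qpochn (a * b * x) q k <> 0) ->
  Cseries (gauss_term a b x q)
    (qpoch_inf (a * x) q * qpoch_inf (b * x) q
     / (qpoch_inf (a * b * x) q * qpoch_inf x q)).
Proof.
intros Hq Hx Hg.
assert (Hx0 := Cmod_ge_0 x).
destruct (gauss_term_bound a b x q Hq Hg) as [K HK].
assert (HxN : forall N, (0 <= Cmod (x * q ^ N) < 1)%R).
{ intros N. split; [apply Cmod_ge_0 |].
  assert (H := Cmod_mult_pow_le x q N Hq). lra. }
assert (Hex := fun N => geom_Cseries _ K _ (HxN N) (HK N)).
destruct (Hex 0%nat) as [s Hs]. simpl in Hs. rewrite Cmult_1_r in Hs.
assert (HK0 : (0 <= K)%R).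
{ specialize (HK 0%nat 0%nat). simpl in HK.
  assert (H := Cmod_ge_0 (gauss_term a b (x * 1) q 0)). lra. }
destruct (Cbounded_mult _ _ (qpochn_bounded (a * x) q Hq)
  (qpochn_bounded (b * x) q Hq)) as [B HB].
assert (HB0 : (0 <= B)%R) by (eapply Rle_trans; [apply Cmod_ge_0 | apply (HB 0%nat)]).
assert (Hz : Ccvg (fun N => qpochn (a * b * x) q N * qpochn x q N * s
  - qpochn (a * x) q N * qpochn (b * x) q N) (RtoC 0)).
{ apply Ccvg_squeeze with (fun N => B * (K * Cmod x / (1 - Cmod x)) * Cmod q ^ N)%R.
  - intros N. destruct (Hex N) as [s' Hs'].
    rewrite (gauss_iterate a b q N Hq x s s' Hx Hg Hs Hs').
    assert (Ht := geom_tail_le _ _ K _ 0 (HxN N) (HK N) Hs').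
    rewrite Csum_0 in Ht.
    replace (gauss_term a b (x * q ^ N) q 0) with (RtoC 1) in Ht
      by (unfold gauss_term; simpl; field).
    replace (_ - _ - 0) with
      (qpochn (a * x) q N * qpochn (b * x) q N * (s' - 1)) by ring.
    rewrite Cmod_mult, Rmult_assoc.
    apply Rmult_le_compat; auto using Cmod_ge_0.
    eapply Rle_trans; [exact Ht |].
    rewrite pow_1.
    apply Rle_trans with (K * Cmod (x * q ^ N) / (1 - Cmod x))%R.
    + apply Rmult_le_compat_l; [apply Rmult_le_pos; auto using Cmod_ge_0 |].
      apply Rinv_le_contravar; [lra |].
      assert (H := Cmod_mult_pow_le x q N Hq). lra.
    + rewrite Cmod_mult, Cmod_pow. right; field; lra.
  - apply lim_scal_geom. split; [apply Cmod_ge_0 | auto]. }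
assert (Hl := Ccvg_minus _ _ _ _
  (Ccvg_mult _ _ _ _ (Ccvg_mult _ _ _ _ (qpoch_inf_correct (a * b * x) q Hq)
     (qpoch_inf_correct x q Hq)) (filterlim_const s))
  (Ccvg_mult _ _ _ _ (qpoch_inf_correct (a * x) q Hq)
     (qpoch_inf_correct (b * x) q Hq))).
assert (E : qpoch_inf (a * b * x) q * qpoch_inf x q * s =
  qpoch_inf (a * x) q * qpoch_inf (b * x) q)
  by exact (Cminus_eq_0 _ _ (Ccvg_unique _ _ _ Hl Hz)).
rewrite <- E.
match goal with |- Cseries _ ?v => assert (Ev : v = s :> C) end;
  [| now rewrite Ev].
field. split; apply qpoch_inf_neq_0; auto.
intros n. now apply qpochn_neq_0.
Qed.

(** * A transformation of nonterminating 3phi2 series *)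

(** General term of 3phi2(a, b, c; d, e; q, z). *)
Definition phi32_term (a b c d e z q : C) (n : nat) : C :=
  qpochn a q n * qpochn b q n * qpochn c q n
  / (qpochn q q n * qpochn d q n * qpochn e q n) * z ^ n.

Lemma phi32_term_bound (a b c d e z q : C) : (Cmod q < 1)%R ->
  (forall n, qpochn d q n <> 0) -> (forall n, qpochn e q n <> 0) ->
  exists K : R, forall n,
    (Cmod (phi32_term a b c d e z q n) <= K * Cmod z ^ n)%R.
Proof.
intros Hq Hd He.
assert (Hqn : forall k, qpochn q q k <> 0) by (intros k; now apply qpochn_neq_0).
destruct (Cbounded_mult _ _
  (Cbounded_mult _ _ (Cbounded_mult _ _ (qpochn_bounded a q Hq)
    (qpochn_bounded b q Hq)) (qpochn_bounded c q Hq))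
  (Cbounded_mult _ _ (Cbounded_mult _ _ (qpochn_inv_bounded q q Hq Hqn)
    (qpochn_inv_bounded d q Hq Hd)) (qpochn_inv_bounded e q Hq He))) as [K HK].
exists K. intros n.
replace (phi32_term a b c d e z q n) with
  (qpochn a q n * qpochn b q n * qpochn c q n *
    (/ qpochn q q n * / qpochn d q n * / qpochn e q n) * z ^ n)
  by (unfold phi32_term; field; repeat split; auto).
rewrite Cmod_mult, Cmod_pow.
apply Rmult_le_compat_r; [apply pow_le, Cmod_ge_0 | apply HK].
Qed.

Lemma phi32_ex (a b c d e z q : C) : (Cmod q < 1)%R -> (Cmod z < 1)%R ->
  (forall n, qpochn d q n <> 0) -> (forall n, qpochn e q n <> 0) ->
  exists s, Cseries (phi32_term a b c d e z q) s.
Proof.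
intros Hq Hz Hd He.
destruct (phi32_term_bound a b c d e z q Hq Hd He) as [K HK].
exact (geom_Cseries _ K _ (conj (Cmod_ge_0 z) Hz) HK).
Qed.

(** The transformation
    3phi2(a, b, c; d, e; de/abc)
      = (e/a, de/bc)_oo / (e, de/abc)_oo 3phi2(a, d/b, d/c; d, de/bc; e/a)
    in the parameters [w = bc/d], [P = d/b], [Q = d/c], [z = de/abc], for which
    no quotient occurs and [d] may vanish. By [q_saalschutz],
    [(b, c)_n / (q, d)_n] is a convolution with summation index [j]. Once the
    sum over [j] is taken outermost, the inner sum is a q-Gauss sum whose value
    is, up to the prefactor, the [j]-th term on the other side. The terms of the
    double series are O(|wz|^j |z|^i), so the two hypotheses [|z| < 1] and
    [|wz| < 1] are what justifies the exchange. *)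
Lemma phi32_transform (A P Q w z q R : C) :
  (Cmod q < 1)%R -> (Cmod z < 1)%R -> (Cmod (w * z) < 1)%R ->
  (forall n, qpochn (P * Q * w) q n <> 0) ->
  (forall n, qpochn (A * w * z) q n <> 0) ->
  (forall n, qpochn (A * z) q n <> 0) ->
  Cseries (phi32_term A P Q (P * Q * w) (A * z) (w * z) q) R ->
  Cseries (phi32_term A (P * w) (Q * w) (P * Q * w) (A * w * z) z q)
    (qpoch_inf (w * z) q * qpoch_inf (A * z) q
     / (qpoch_inf (A * w * z) q * qpoch_inf z q) * R).
Proof.
intros Hq Hz Hwz HM HE HAz HR.
assert (Hqn : forall k, qpochn q q k <> 0) by (intros k; now apply qpochn_neq_0).
set (c := qpoch_inf (w * z) q * qpoch_inf (A * z) q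
     / (qpoch_inf (A * w * z) q * qpoch_inf z q)).
(* The row [j] and column [i] entry contributes to the coefficient [n = j + i]. *)
set (t := fun j i => qpochn A q (j + i) / qpochn (A * w * z) q (j + i)
  * z ^ (j + i) * saalschutz_term P Q w q j i).
set (r := Rmax (Cmod z) (Cmod (w * z))).
assert (Hr : (0 <= r < 1)%R).
{ split; [apply Rle_trans with (Cmod z); [apply Cmod_ge_0 | apply Rmax_l] |].
  now apply Rmax_lub_lt. }
assert (Ht : exists K, forall j i, (Cmod (t j i) <= K * r ^ (j + i))%R).
{ destruct (Cbounded_mult _ _ (qpochn_bounded A q Hq)
    (qpochn_inv_bounded _ q Hq HE)) as [K1 H1].
  destruct (Cbounded_mult _ _ (Cbounded_mult _ _ (qpochn_bounded P q Hq)
    (qpochn_bounded Q q Hq)) (Cbounded_mult _ _ (qpochn_inv_bounded q q Hq Hqn)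
    (qpochn_inv_bounded _ q Hq HM))) as [K2 H2].
  destruct (Cbounded_mult _ _ (qpochn_bounded w q Hq)
    (qpochn_inv_bounded q q Hq Hqn)) as [K3 H3].
  exists (K1 * (K2 * K3))%R. intros j i.
  replace (t j i) with
    (qpochn A q (j + i) * / qpochn (A * w * z) q (j + i) *
     ((qpochn P q j * qpochn Q q j * (/ qpochn q q j * / qpochn (P * Q * w) q j))
      * (qpochn w q i * / qpochn q q i)) * ((w * z) ^ j * z ^ i))
    by (unfold t, saalschutz_term; rewrite Cpow_mult_l, (Cpow_add_r z); field;
        repeat split; auto).
  rewrite Cmod_mult. apply Rmult_le_compat; auto using Cmod_ge_0.
  - rewrite Cmod_mult. apply Rmult_le_compat; auto using Cmod_ge_0.
    rewrite Cmod_mult. apply Rmult_le_compat; auto using Cmod_ge_0.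
  - rewrite Cmod_mult, !Cmod_pow, pow_add.
    apply Rmult_le_compat; try (apply pow_le, Cmod_ge_0);
      apply pow_incr; split; auto using Cmod_ge_0; [apply Rmax_r | apply Rmax_l]. }
destruct Ht as [K Ht].
(* Each row is a q-Gauss sum with parameters [A q^j], [w] and argument [z]. *)
assert (Hrow : forall j,
  Cseries (t j) (c * phi32_term A P Q (P * Q * w) (A * z) (w * z) q j)).
{ intros j.
  assert (Hg : forall k, qpochn (A * q ^ j * w * z) q k <> 0).
  { intros k E. apply (HE (j + k)%nat). rewrite qpochn_add.
    replace (A * w * z * q ^ j) with (A * q ^ j * w * z) by ring.
    rewrite E. ring. }
  assert (G := Cseries_mult_l (qpochn A q j / qpochn (A * w * z) q j * z ^ j
      * (qpochn P q j * qpochn Q q j / (qpochn q q j * qpochn (P * Q * w) q j)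
         * w ^ j)) _ _ (q_gauss (A * q ^ j) w z q Hq Hz Hg)).
  match type of G with Cseries _ ?v =>
    replace (c * phi32_term A P Q (P * Q * w) (A * z) (w * z) q j) with v end.
  - revert G. apply is_series_ext. intros i.
    change (qpochn A q j / qpochn (A * w * z) q j * z ^ j
      * (qpochn P q j * qpochn Q q j / (qpochn q q j * qpochn (P * Q * w) q j)
         * w ^ j) * gauss_term (A * q ^ j) w z q i = t j i).
    unfold t, saalschutz_term, gauss_term. rewrite !qpochn_add, Cpow_add_r.
    replace (A * w * z * q ^ j) with (A * q ^ j * w * z) by ring.
    field. repeat split; auto.
  - unfold c, phi32_term.
    rewrite (qpoch_inf_split (A * z) q j Hq), (qpoch_inf_split (A * w * z) q j Hq).
    replace (A * q ^ j * z) with (A * z * q ^ j) by ring.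
    replace (A * q ^ j * w * z) with (A * w * z * q ^ j) in * by ring.
    rewrite Cpow_mult_l.
    assert (H1 : qpoch_inf (A * w * z * q ^ j) q <> 0) by now apply qpoch_inf_neq_0.
    assert (H2 : qpoch_inf z q <> 0).
    { apply qpoch_inf_neq_0; auto. intros n. now apply qpochn_neq_0. }
    field. repeat split; auto. }
assert (H := Cseries_swap t _ _ K r Hr Ht Hrow (Cseries_mult_l c _ _ HR)).
revert H. apply is_series_ext. intros n.
rewrite (Csum_ext _ (fun j => qpochn A q n / qpochn (A * w * z) q n * z ^ n
  * saalschutz_term P Q w q j (n - j))).
- rewrite Csum_mult_l, q_saalschutz by auto.
  change (qpochn A q n / qpochn (A * w * z) q n * z ^ n *
    (qpochn (P * w) q n * qpochn (Q * w) q n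
     / (qpochn q q n * qpochn (P * Q * w) q n)) =
    phi32_term A (P * w) (Q * w) (P * Q * w) (A * w * z) z q n).
  unfold phi32_term. field. repeat split; auto.
- intros k Hk. unfold t. now replace (k + (n - k))%nat with n by lia.
Qed.

(** * Shifting the summation index by m *)

Lemma Cpowz_sub (x : C) (n m : nat) : x <> 0 ->
  Cpowz x (Z.of_nat n - Z.of_nat m) = x ^ n / x ^ m.
Proof.
intros Hx.
destruct (Z.of_nat n - Z.of_nat m)%Z as [|p|p] eqn:E; simpl.
- replace n with m by lia. field. now apply Cpow_nz.
- replace n with (m + Pos.to_nat p)%nat by lia.
  rewrite Cpow_add_r. field. now apply Cpow_nz.
- replace m with (n + Pos.to_nat p)%nat by lia.
  rewrite Cpow_add_r. field. split; now apply Cpow_nz.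
Qed.

Lemma qpoch_wd_opp (x q : C) (m : nat) :
  qpoch_wd x q (- Z.of_nat m) -> qpochn (x / q ^ m) q m <> 0.
Proof.
destruct m as [|m]; intros H; [apply C1_nz |].
unfold qpoch_wd in H. simpl Z.opp in H. cbv beta iota in H.
simpl Cpowz in H. rewrite SuccNat2Pos.id_succ in H. exact H.
Qed.

(** Substituting [k = n - m] makes a sum over [k >= -m] start at 0: up to a factor
    independent of [n], the symbol [(x)_(n-m)] is [(x q^-m)_n]. *)
Lemma qpoch_sub (x q : C) (n m : nat) : q <> 0 ->
  qpochn (x / q ^ m) q m <> 0 ->
  qpoch x q (Z.of_nat n - Z.of_nat m) =
  qpochn (x / q ^ m) q n / qpochn (x / q ^ m) q m.
Proof.
intros Hq Hx.
assert (Hqm := fun k => Cpow_nz q k Hq).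
assert (Hpos : forall k, n = (m + k)%nat ->
  qpochn x q k = qpochn (x / q ^ m) q n / qpochn (x / q ^ m) q m).
{ intros k ->. rewrite qpochn_add.
  replace (x / q ^ m * q ^ m) with x by (field; auto). field; auto. }
destruct (Z.of_nat n - Z.of_nat m)%Z as [|p|p] eqn:E.
- apply (Hpos 0%nat). lia.
- apply (Hpos (Pos.to_nat p)). lia.
- unfold qpoch. simpl Cpowz.
  assert (Em : m = (n + Pos.to_nat p)%nat) by lia.
  rewrite Em in Hx |- *. rewrite qpochn_add in *.
  replace (x / q ^ (n + Pos.to_nat p) * q ^ n) with (x * / q ^ Pos.to_nat p) in *
    by (rewrite Cpow_add_r; field; auto).
  field. split; intros H; apply Hx; rewrite H; ring.
Qed.

(** Reversal: [(b q^-m)_m = (-b)^m q^(-m(m+1)/2) (q/b)_m]. Comparing two bases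
    [b] and [b'] eliminates the sign and the power of [q]. *)
Lemma qpochn_reverse (b b' q : C) (m : nat) :
  q <> 0 -> b <> 0 -> b' <> 0 ->
  qpochn (b / q ^ m) q m * (b' ^ m * qpochn (q / b') q m) =
  qpochn (b' / q ^ m) q m * (b ^ m * qpochn (q / b) q m).
Proof.
intros Hq Hb Hb'.
induction m as [|m IH]; [reflexivity |].
assert (Hs : forall x, qpochn (x / q ^ S m) q (S m) =
  (1 - x / q ^ S m) * qpochn (x / q ^ m) q m).
{ intros x. rewrite qpochn_succ_l. do 2 f_equal. simpl. field.
  split; auto. now apply Cpow_nz. }
rewrite !Hs, !qpochn_S, !Cpow_S.
assert (Hqm := Cpow_nz q m Hq).
transitivity (qpochn (b / q ^ m) q m * (b' ^ m * qpochn (q / b') q m)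
  * ((1 - b / (q * q ^ m)) * (b' * (1 - q / b' * q ^ m)))); [ring |].
rewrite IH. field. repeat split; auto.
Qed.

Theorem proposition3p1 (q : C) (m : nat) (a b c d z : C)
  (Hq0 : q <> 0) (Hq1 : (Cmod q < 1)%R)
  (* every division in the statement is by a nonzero number *)
  (Ha : a <> 0) (Hb : b <> 0) (Hd : d <> 0) (Hz : z <> 0)
  (Hsymbols : forall k : Z, (- Z.of_nat m <= k)%Z ->
     List.Forall (fun x => qpoch_wd x q k)
       [a; b; c * d * q ^ m / (a * b * z); c; d; q ^ (1 + m);
        c * q ^ m / b; a * b * z / d; a * z])
  (Hden_lhs : forall k : Z, (- Z.of_nat m <= k)%Z ->
     qpochs [c; d] q k * qpoch (q ^ (1 + m)) q k <> 0)
  (Hden_rhs : forall k : Z, (- Z.of_nat m <= k)%Z ->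
     qpochs [c; q ^ (1 + m); a * z] q k <> 0)
  (Hden_inf : qpochs_inf [z; d] q <> 0)
  (Hden_m : qpochs [q / b; c * d / (a * b * z)] q (Z.of_nat m) <> 0)
  (Hz1 : (Cmod z < 1)%R) (Hda : (Cmod (d / a) < 1)%R) :
  exists L R : C,
    is_series_from m
      (fun k => qpochs [a; b] q k * qpoch (c * d * q ^ m / (a * b * z)) q k
                / (qpochs [c; d] q k * qpoch (q ^ (1 + m)) q k)
                * Cpowz z k) L /\
    is_series_from m
      (fun k => qpochs [a; c * q ^ m / b; a * b * z / d] q k
                / qpochs [c; q ^ (1 + m); a * z] q k
                * Cpowz (d / a) k) R /\
    L = qpochs_inf [a * z; d / a] q / qpochs_inf [z; d] q
        * (qpochs [c / b; d * q / (a * b * z)] q (Z.of_nat m)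
           / qpochs [q / b; c * d / (a * b * z)] q (Z.of_nat m))
        * R.
Proof.
assert (Hqm : q ^ m <> 0) by now apply Cpow_nz.
assert (Hqn : forall n, qpochn q q n <> 0) by (intros n; now apply qpochn_neq_0).
(* [X x n] is [(x q^-m)_n], the shifted form of every symbol of the statement. *)
set (X := fun x => qpochn (x / q ^ m) q).
assert (HX : forall x, qpoch_wd x q (- Z.of_nat m) -> X x m <> 0)
  by (intros x; apply qpoch_wd_opp).
assert (Hw := Hsymbols (- Z.of_nat m)%Z (Z.le_refl _)).
rewrite !List.Forall_cons_iff in Hw.
destruct Hw as (Wa & Wb & WC & Wc & Wd & Wq & WP & WQ & Waz & _).
apply HX in Wa, Wb, WC, Wc, Wd, Wq, WP, WQ, Waz.
assert (HS : forall x n, X x m <> 0 ->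
  qpoch x q (Z.of_nat n - Z.of_nat m) = X x n / X x m)
  by (intros x n Hx; now apply qpoch_sub).
assert (HS0 : forall x n, X x m <> 0 ->
  qpoch x q (Z.of_nat n - Z.of_nat m) <> 0 -> X x n <> 0).
{ intros x n Hx Hn E. apply Hn. rewrite HS, E by auto. unfold Cdiv. ring. }
assert (Hle : forall n, (- Z.of_nat m <= Z.of_nat n - Z.of_nat m)%Z)
  by (intros n; lia).
assert (Hc : forall n, X c n <> 0).
{ intros n. apply HS0; auto. intros E. apply (Hden_lhs _ (Hle n)).
  simpl. rewrite E. ring. }
assert (Hdn : forall n, X d n <> 0).
{ intros n. apply HS0; auto. intros E. apply (Hden_lhs _ (Hle n)).
  simpl. rewrite E. ring. }
assert (Haz : forall n, X (a * z) n <> 0).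
{ intros n. apply HS0; auto. intros E. apply (Hden_rhs _ (Hle n)).
  simpl. rewrite E. ring. }
assert (EXq : X (q ^ (1 + m)) = qpochn q q).
{ unfold X. f_equal. simpl. field; auto. }
assert (EXP : X (c * q ^ m / b) = qpochn (c / b) q).
{ unfold X. f_equal. field; auto. }
assert (EXC : X (c * d * q ^ m / (a * b * z)) = qpochn (c * d / (a * b * z)) q).
{ unfold X. f_equal. field; auto. }
(* The arguments of [phi32_transform] at [A = a q^-m], [w = d/(az)], [P = c/b]
   and [Q = abz q^-m / d]. *)
assert (Hwz : d / (a * z) * z = d / a) by (field; auto).
assert (HPw : c / b * (d / (a * z)) = c * d / (a * b * z)) by (field; auto).
assert (HQw : a * b * z / d / q ^ m * (d / (a * z)) = b / q ^ m)
  by (field; auto).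
assert (HPQw : c / b * (a * b * z / d / q ^ m) * (d / (a * z)) = c / q ^ m)
  by (field; auto).
assert (HAwz : a / q ^ m * (d / (a * z)) * z = d / q ^ m) by (field; auto).
assert (HAz : a / q ^ m * z = a * z / q ^ m) by (field; auto).
destruct (phi32_ex (a / q ^ m) (c / b) (a * b * z / d / q ^ m) (c / q ^ m)
  (a * z / q ^ m) (d / a) q Hq1 Hda Hc Haz) as [R HR].
assert (HL := phi32_transform (a / q ^ m) (c / b) (a * b * z / d / q ^ m)
  (d / (a * z)) z q R).
rewrite HPw, HQw, HPQw, HAwz, HAz, Hwz in HL.
specialize (HL Hq1 Hz1 Hda Hc Hdn Haz HR).
match type of HL with Cseries _ ?v => set (L := v) in * end.
(* The factors [(x)_(-m)] split off from the two sums by [qpoch_sub]. *)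
set (kL := X c m * X d m * X (q ^ (1 + m)) m
  / (X a m * X b m * X (c * d * q ^ m / (a * b * z)) m * z ^ m)).
set (kR := X c m * X (q ^ (1 + m)) m * X (a * z) m
  / (X a m * X (c * q ^ m / b) m * X (a * b * z / d) m * (d / a) ^ m)).
exists (kL * L), (kR * R).
assert (Hzm := Cpow_nz z m Hz).
assert (Hda0 : d / a <> 0).
{ unfold Cdiv. apply Cmult_neq_0; auto. intros E. apply C1_nz.
  rewrite <- (Cinv_r a Ha), E. ring. }
assert (Hdam := Cpow_nz (d / a) m Hda0).
rewrite EXq, EXP, EXC in *.
split; [| split].
- assert (G := Cseries_mult_l kL _ _ HL). revert G.
  apply is_series_ext. intros n.
  change (kL * phi32_term (a / q ^ m) (c * d / (a * b * z)) (b / q ^ m) (c / q ^ m)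
    (d / q ^ m) z q n =
    qpoch a q (Z.of_nat n - Z.of_nat m) *
    (qpoch b q (Z.of_nat n - Z.of_nat m) * 1) *
    qpoch (c * d * q ^ m / (a * b * z)) q (Z.of_nat n - Z.of_nat m) /
    (qpoch c q (Z.of_nat n - Z.of_nat m) *
     (qpoch d q (Z.of_nat n - Z.of_nat m) * 1) *
     qpoch (q ^ (1 + m)) q (Z.of_nat n - Z.of_nat m)) *
    Cpowz z (Z.of_nat n - Z.of_nat m)).
  rewrite !HS, Cpowz_sub by (rewrite ?EXq, ?EXC; auto).
  unfold kL, phi32_term. rewrite EXq, EXC. unfold X in *.
  field. repeat split; auto.
- assert (G := Cseries_mult_l kR _ _ HR). revert G.
  apply is_series_ext. intros n.
  change (kR * phi32_term (a / q ^ m) (c / b) (a * b * z / d / q ^ m) (c / q ^ m)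
    (a * z / q ^ m) (d / a) q n =
    qpoch a q (Z.of_nat n - Z.of_nat m) *
    (qpoch (c * q ^ m / b) q (Z.of_nat n - Z.of_nat m) *
     (qpoch (a * b * z / d) q (Z.of_nat n - Z.of_nat m) * 1)) /
    (qpoch c q (Z.of_nat n - Z.of_nat m) *
     (qpoch (q ^ (1 + m)) q (Z.of_nat n - Z.of_nat m) *
      (qpoch (a * z) q (Z.of_nat n - Z.of_nat m) * 1))) *
    Cpowz (d / a) (Z.of_nat n - Z.of_nat m)).
  rewrite !HS, Cpowz_sub by (rewrite ?EXq, ?EXP; auto).
  unfold kR, phi32_term. rewrite EXq, EXP. unfold X in *.
  set (u := d / a) in *.
  field. repeat split; auto.
- assert (Hnat : forall x, qpoch x q (Z.of_nat m) = qpochn x q m)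
    by (intros x; destruct m; [reflexivity | simpl; now rewrite SuccNat2Pos.id_succ]).
  simpl qpochs_inf in *. simpl qpochs in Hden_m |- *.
  rewrite !Hnat in *.
  (* The constants agree once [(b q^-m)_m] and [(abz/d q^-m)_m] are reversed. *)
  assert (Hrev := qpochn_reverse b (a * b * z / d) q m Hq0 Hb).
  assert (Hbne : qpochn (q / b) q m <> 0)
    by (intros E; apply Hden_m; rewrite E; ring).
  assert (Hi1 : qpoch_inf z q <> 0) by (intros E; apply Hden_inf; rewrite E; ring).
  assert (Hi2 : qpoch_inf d q <> 0) by (intros E; apply Hden_inf; rewrite E; ring).
  assert (Hb' : a * b * z / d = b * (z / (d / a))) by (field; auto).
  assert (Hq' : q / (a * b * z / d) = d * q / (a * b * z)) by (field; auto).
  assert (Hzda : z / (d / a) <> 0).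
  { intros E. apply Hz. replace z with (z / (d / a) * (d / a)) by (field; auto).
    rewrite E. ring. }
  rewrite Hq' in Hrev.
  assert (Hbz : a * b * z / d <> 0) by (rewrite Hb'; now apply Cmult_neq_0).
  specialize (Hrev Hbz).
  assert (Hpow : (a * b * z / d) ^ m = b ^ m * (z / (d / a)) ^ m)
    by now rewrite Hb', Cpow_mult_l.
  rewrite Hpow in Hrev.
  assert (Hbm := Cpow_nz b m Hb).
  assert (Hzdam := Cpow_nz _ m Hzda).
  replace (qpochn (d * q / (a * b * z)) q m) with
    (X (a * b * z / d) m * qpochn (q / b) q m / (X b m * (z / (d / a)) ^ m)).
  + unfold L, kL, kR. rewrite EXq, EXP, EXC. unfold X in *.
    rewrite (qpoch_inf_split (a * z / q ^ m) q m Hq1),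
      (qpoch_inf_split (d / q ^ m) q m Hq1).
    replace (a * z / q ^ m * q ^ m) with (a * z) by (field; auto).
    replace (d / q ^ m * q ^ m) with d by (field; auto).
    replace (z ^ m) with ((z / (d / a)) ^ m * (d / a) ^ m)
      by (rewrite <- Cpow_mult_l; f_equal; field; auto).
    set (u := (d / a)) in *.
    field. repeat split; auto.
  + unfold X in *.
    transitivity (qpochn (a * b * z / d / q ^ m) q m * (b ^ m * qpochn (q / b) q m)
      / (qpochn (b / q ^ m) q m * (b ^ m * (z / (d / a)) ^ m))).
    * set (v := z / (d / a)) in *. field. auto.
    * rewrite <- Hrev. set (v := z / (d / a)) in *. field. auto.
Qed.
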